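(* For all real $r$ with $0\le r\le \tfrac12$, the reflection formula $$T(r) = T\left(\tfrac12 - r\right)$$ holds.
   Context: For real $r$ with $0\le r\le \tfrac12$, $T(r) := \int_0^{r\pi}\log(\tan\theta)\,d\theta$ (the integrand has integrable logarithmic singularities at $0$ and $\pi/2$). *)

(* Defs.v *)
From HB Require Import structures.
From mathcomp Require Import all_boot all_order all_algebra.
From mathcomp Require Import all_classical all_reals all_analysis.

Set Implicit Arguments.
Unset Strict Implicit.
Unset Printing Implicit Defensive.

Import Order.TTheory GRing.Theory Num.Theory.
Import numFieldNormedType.Exports.

Local Open Scope classical_set_scope.
Local Open Scope ring_scope.

(* Lebesgue integral of log tan from 0 to r pi, for 0 <= r <= 1/2.  The open
   interval leaves out the null set of endpoints, where log tan may be singular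
   and where the total functions [tan] and [ln] take conventional values.  Since
   log tan is integrable on ]0, pi/2[, the real-valued integral is the usual
   one. *)
Definition T (R : realType) (r : R) : R :=
  \int[@lebesgue_measure R]_(theta in `]0, r * pi[) ln (tan theta).

(* Main.v *)
Require Import Defs.
From HB Require Import structures.
From mathcomp Require Import all_boot all_order all_algebra.
From mathcomp Require Import all_classical all_reals all_analysis.
From mathcomp Require Import measurable_realfun ring lra.

Set Implicit Arguments.
Unset Strict Implicit.
Unset Printing Implicit Defensive.

Import Order.TTheory GRing.Theory Num.Theory.
Import numFieldNormedType.Exports.

Local Open Scope classical_set_scope.
Local Open Scope ring_scope.

(** The idea is the complement rule: [tan (pi/2 - x)] is the inverse of
    [tan x], so [ln \o tan] is odd about [pi/4], and its integral over any
    measurable subset of [`]0, pi/2[] that is symmetric about [pi/4] vanishes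
    ([Rintegral_reflect_odd]).

    By the symmetry of the formula one may assume [r <= 1/2 - r].  If [0 < r],
    the range of integration of [T (1/2 - r)] is that of [T r] followed by
    [`[r pi, pi/2 - r pi[].  Up to an endpoint, the latter is symmetric about
    [pi/4], and it stays away from the singularities, so it contributes a finite
    integral, which is zero, and the two sides agree.  The additivity used here
    holds for extended-real integrals as soon as one piece is finite; this is
    why the singularity at [0], common to both sides, never has to be estimated.

    If [r = 0], then [T 0] is an integral over the empty set and [T (1/2)] is one
    over the symmetric interval [`]0, pi/2[]. *)

Section reflection.
Context {R : realType}.
Notation mu := (@lebesgue_measure R).
Local Open Scope ereal_scope.

Lemma measurable_reflect (c : R) :
  measurable_fun setT
    ((fun x => c - x)%R : measurableTypeR R -> measurableTypeR R).
Proof. exact: measurable_funB. Qed.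

(** Lebesgue measure is determined by its values on intervals, and a reflection
    preserves lengths. *)
Lemma lebesgue_measure_reflect (c : R) (A : set R) : measurable A ->
  pushforward mu
    ((fun x => c - x)%R : measurableTypeR R -> measurableTypeR R) A = mu A.
Proof.
move=> mA; pose phi := (fun x => c - x)%R : measurableTypeR R -> measurableTypeR R.
have mphi : measurable_fun setT phi := @measurable_reflect c.
pose phi_mfun : {mfun _ >-> _} :=
  HB.pack phi (isMeasurableFun.Build _ _ _ _ _ mphi).
apply/esym.
apply: (@lebesgue_measure_unique R (pushforward mu phi_mfun)) => //.
move=> _ [[a b]] _ <-; rewrite /= -[RHS]/(mu (phi @^-1` `]a, b])).
have -> : phi @^-1` `]a, b] = `[(c - b)%R, (c - a)%R[%classic.
  by apply/seteqP; split => x; rewrite /= !in_itv/= /phi => /andP[? ?];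
    apply/andP; split; lra.
rewrite !lebesgue_measure_itv/= !lte_fin.
have -> : (c - b < c - a)%R = (a < b)%R by apply/idP/idP => ?; lra.
by case: ifP => // _; rewrite -!EFinD; congr EFin; ring.
Qed.

Lemma ge0_integral_reflect (c : R) (D : set R) (f : R -> \bar R) :
  measurable D -> measurable_fun D f -> {in D, forall x, 0 <= f x} ->
  \int[mu]_(x in D) f x =
  \int[mu]_(x in (fun x => c - x)%R @^-1` D) f (c - x)%R.
Proof.
move=> mD mf f0.
apply: etrans (ge0_integral_pushforward (@measurable_reflect c) mu mD mf f0).
apply: eq_measure_integral => [|mphi A mA _]; first exact: measurable_reflect.
exact: esym (lebesgue_measure_reflect c mA).
Qed.

(** The reflection exchanges the positive and the negative part of the
    integrand, which therefore have the same integral.  If this common value is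
    infinite, then the extended-real difference of the two is infinite by
    convention, and its real part is [0] as well. *)
Lemma Rintegral_reflect_odd (c : R) (D : set R) (f : R -> R) :
  measurable D -> measurable_fun D f ->
  (fun x => c - x)%R @^-1` D = D ->
  {in D, forall x, f (c - x)%R = - f x}%R ->
  (\int[mu]_(x in D) f x = 0)%R.
Proof.
move=> mD mf symD oddf.
have mEf : measurable_fun D (EFin \o f) by exact/measurable_EFinP.
rewrite /Rintegral integralE.
rewrite (@ge0_integral_reflect c _ _ mD (measurable_funepos mEf))//.
rewrite symD.
have -> : \int[mu]_(x in D) (fun x => (f x)%:E)^\+ (c - x)%R =
          \int[mu]_(x in D) (fun x => (f x)%:E)^\- x.
  by apply: eq_integral => x xD; rewrite funeposE funenegE oddf.
by case: (\int[mu]_(x in D) _) => [s| |] //=; rewrite subrr.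
Qed.

End reflection.

Section ln_tan.
Context {R : realType}.
Implicit Types x : R.

Lemma sin_cos_gt0_pihalf x : x \in `]0, pi / 2[ -> 0 < sin x /\ 0 < cos x.
Proof.
rewrite in_itv/= => /andP[x0 xpi2]; split.
  by apply: sin_gt0_pihalf; rewrite x0.
by apply: cos_gt0_pihalf; rewrite xpi2 andbT; lra.
Qed.

Lemma tan_gt0_pihalf x : x \in `]0, pi / 2[ -> 0 < tan x.
Proof. by move=> /sin_cos_gt0_pihalf[? ?]; rewrite divr_gt0. Qed.

Lemma tanBpihalf x : tan (pi / 2 - x) = (tan x)^-1.
Proof.
by rewrite /tan -(opprB x) sinN cosN sinBpihalf cosBpihalf opprK invf_div.
Qed.

Lemma ln_tanBpihalf x : x \in `]0, pi / 2[ ->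
  ln (tan (pi / 2 - x)) = - ln (tan x).
Proof. by move=> x0; rewrite tanBpihalf lnV// posrE tan_gt0_pihalf. Qed.

Lemma continuous_ln_tan x : x \in `]0, pi / 2[ ->
  {for x, continuous (fun y => ln (tan y))}.
Proof.
move=> x0; have [_ cx] := sin_cos_gt0_pihalf x0.
apply: continuous_comp; first by apply: continuous_tan; rewrite gt_eqF.
by apply: continuous_ln; exact: tan_gt0_pihalf.
Qed.

Lemma measurable_ln_tan : measurable_fun `]0, pi / 2[ (fun x : R => ln (tan x)).
Proof.
apply: open_continuous_measurable_fun => // x; rewrite inE => x0.
exact: continuous_ln_tan.
Qed.

Lemma integrable_ln_tan (a b : R) : 0 < a -> b < pi / 2 ->
  (@lebesgue_measure R).-integrable `[a, b] (fun x => (ln (tan x))%:E).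
Proof.
move=> a0 b1; apply: continuous_compact_integrable; first exact: segment_compact.
apply: continuous_in_subspaceT => x; rewrite inE/= in_itv/= => /andP[ax xb].
apply: continuous_ln_tan; rewrite in_itv/=; apply/andP; split.
  exact: lt_le_trans ax.
exact: le_lt_trans b1.
Qed.

Lemma Rintegral_ln_tan_sym (a : R) : 0 <= a ->
  \int[@lebesgue_measure R]_(x in `]a, pi / 2 - a[) ln (tan x) = 0.
Proof.
move=> a0.
have sub : `]a, pi / 2 - a[ `<=` `]0, pi / 2[.
  by move=> x; rewrite /= !in_itv/= => /andP[? ?]; apply/andP; split; lra.
apply: (@Rintegral_reflect_odd R (pi / 2)) => //.
- exact: measurable_funS measurable_ln_tan.
- by apply/seteqP; split => x; rewrite /= !in_itv/= => /andP[? ?];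
    apply/andP; split; lra.
- by move=> x; rewrite inE => /sub; exact: ln_tanBpihalf.
Qed.

End ln_tan.

Lemma T_reflect_le_quarter (R : realType) (r : R) :
  0 <= r -> r <= 1 / 2 - r -> T r = T (1 / 2 - r).
Proof.
rewrite le_eqVlt => /predU1P[<- _|r0 rr].
  rewrite /T mul0r set_itvoo0 Rintegral_set0 subr0.
  rewrite -[X in `]0, X[](subr0 _) (_ : 1 / 2 * pi = pi / 2); last by ring.
  by rewrite Rintegral_ln_tan_sym.
have pi0 := @pi_gt0 R.
rewrite /T; set a := r * pi.
have a0 : 0 < a by rewrite mulr_gt0.
have : a <= (1 / 2 - r) * pi by rewrite ler_pM2r.
have -> : (1 / 2 - r) * pi = pi / 2 - a by rewrite /a; field.
set b := pi / 2 - a => ab.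
have bpi : b < pi / 2 by rewrite /b; lra.
have sub : `]0, b[ `<=` `]0, (pi / 2 : R)[.
  by apply: subset_itvl; rewrite bnd_simp ltW.
have split_ab : `]0, b[%classic = `]0, a[ `|` `[a, b[.
  by rewrite -itv_bndbnd_setU// bnd_simp.
have mab : measurable_fun `]a, b[ (fun x : R => (ln (tan x))%:E).
  apply/measurable_EFinP; apply: measurable_funS measurable_ln_tan => //.
  by apply: subset_trans sub; apply: subset_itvr; rewrite bnd_simp ltW.
(* [Rintegral_ln_tan_sym] gives the real part of the integral; finiteness turns
   it into the extended-real value. *)
have mid0 : (\int[@lebesgue_measure R]_(x in `[a, b[) (ln (tan x))%:E = 0)%E.
  rewrite integral_itv_bndoo// -[LHS]fineK.
    by rewrite -/(Rintegral _ _ _) Rintegral_ln_tan_sym// ltW.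
  apply: integrable_fin_num => //.
  apply: integrableS (integrable_ln_tan a0 bpi) => //.
  exact: subset_itv_oo_cc.
rewrite /Rintegral split_ab integral_setU ?mid0 ?adde0//.
- rewrite -split_ab; apply/measurable_EFinP.
  exact: measurable_funS measurable_ln_tan.
- apply/disj_setPLR => x /=; rewrite !in_itv/= => /andP[_ xa].
  by apply/negP; rewrite negb_and -ltNge xa.
Qed.

Theorem theorem3 (R : realType) (r : R) (hr0 : 0 <= r) (hr1 : r <= 1 / 2) :
  T r = T (1 / 2 - r).
Proof.
have [rr|rr] := leP r (1 / 2 - r); first exact: T_reflect_le_quarter.
have -> : T r = T (1 / 2 - (1 / 2 - r)) by congr T; ring.
by apply/esym/T_reflect_le_quarter; lra.
Qed.
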